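(* Let $\mathfrak g$ be a finite-dimensional Lie algebra over a field of characteristic zero, and define $$\mathfrak i(\mathfrak g)=\sum_{k\in\mathbb N}C_k(\mathfrak g)\cap\mathfrak g^k,\qquad \mathfrak j(\mathfrak g)=\bigcap_{k\in\mathbb N}\big(C_k(\mathfrak g)+\mathfrak g^k\big).$$ Then: (i) $\mathfrak i(\mathfrak g)\subset\mathfrak j(\mathfrak g)$. (ii) There exists $m\ge 1$ such that $\mathfrak j(\mathfrak g)=C(\mathfrak g)+\sum_{k=1}^{m-1}C_{k+1}(\mathfrak g)\cap\mathfrak g^k+\mathfrak g^m$. (iii) $\mathfrak j(\mathfrak g)$ is Abelian if and only if there is an $\ell\ge1$ such that $\mathfrak g^\ell$ is Abelian. (iv) If $\mathfrak g$ admits an invariant metric and $\mathfrak j(\mathfrak g)$ is Abelian, then $[\mathfrak g,\mathfrak j(\mathfrak g)]\subset\mathfrak i(\mathfrak g)$ and $\mathfrak i(\mathfrak g)^\perp=\mathfrak j(\mathfrak g)$ (orthogonal with respect to the invariant metric). (v) If $\mathfrak g$ is a solvable non-Abelian quadratic Lie algebra having one Abelian descending central ideal, then $\mathfrak i(\mathfrak g)\ne\{0\}\ne\mathfrak j(\mathfrak g)$.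
   Context: $\mathbb N=\{1,2,\dots\}$. Descending central series: $\mathfrak g^0=\mathfrak g$, $\mathfrak g^\ell=[\mathfrak g,\mathfrak g^{\ell-1}]$ for $\ell\in\mathbb N$. $C(\mathfrak g)$ is the center. Derived central series: $C_1(\mathfrak g)=C(\mathfrak g)$ and $C_\ell(\mathfrak g)=\pi_{\ell-1}^{-1}\big(C(\mathfrak g/C_{\ell-1}(\mathfrak g))\big)$ for $\ell>1$, where $\pi_{\ell-1}:\mathfrak g\to\mathfrak g/C_{\ell-1}(\mathfrak g)$ is the canonical projection. $\mathfrak g$ has an Abelian descending central ideal if $[\mathfrak g^\ell,\mathfrak g^\ell]=\{0\}$ for some $\ell\in\mathbb N$. An invariant metric on $\mathfrak g$ is a non-degenerate symmetric bilinear form $B$ with $B([x,y],z)=B(x,[y,z])$ for all $x,y,z\in\mathfrak g$; a quadratic Lie algebra is a Lie algebra equipped with an invariant metric. A Lie algebra is solvable if its derived series $\mathfrak g^{(0)}=\mathfrak g$, $\mathfrak g^{(\ell)}=[\mathfrak g^{(\ell-1)},\mathfrak g^{(\ell-1)}]$ reaches $\{0\}$. *)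

(* Defs.v *)
From HB Require Import structures.
From mathcomp Require Import all_boot all_order all_algebra.
From mathcomp Require Import boolp.

Set Implicit Arguments.
Unset Strict Implicit.
Unset Printing Implicit Defensive.
Import GRing.Theory.
Local Open Scope ring_scope.

(* Sum and intersection of an infinite family (U k)_(k >= 1) of subspaces; the
   index 0 is never used. *)
Section InfiniteFamilies.
Variables (F : fieldType) (V : vectType F) (U : nat -> {vspace V}).

Lemma vbigsum_exists : exists W : {vspace V}, forall v,
  v \in W <-> exists n, v \in (\sum_(1 <= k < n) U k)%VS.
Proof.
pose S n := (\sum_(1 <= k < n) U k)%VS.
have SS m n : (m <= n)%N -> (S m <= S n)%VS.
  move=> mn; case: (leqP 1 m) => m0; last first.
    by rewrite /S big_geq ?sub0v // ltnW.
  by rewrite /S (big_cat_nat m0 mn) /= addvSl.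
pose P d := `[< exists n, \dim (S n) = d >].
have exP : exists d, P d by exists (\dim (S 0)); apply/asboolP; exists 0%N.
have bdP d : P d -> (d <= \dim {:V})%N.
  by move=> /asboolP[n <-]; rewrite dimvS ?subvf.
case: (ex_maxnP exP bdP) => d /asboolP[N dN] dmax.
exists (S N) => v; split=> [vN|[n vn]]; first by exists N.
have /eqP-> : S N == S (maxn N n).
  rewrite eqEdim SS ?leq_maxl //= dN dmax //; apply/asboolP.
  by exists (maxn N n).
exact: subvP (SS _ _ (leq_maxr N n)) _ vn.
Qed.

Lemma vbigcap_exists : exists W : {vspace V}, forall v,
  v \in W <-> forall k, (1 <= k)%N -> v \in U k.
Proof.
pose S n := (\bigcap_(1 <= k < n) U k)%VS.
have SP n v : v \in S n <-> forall k, (1 <= k < n)%N -> v \in U k.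
  elim: n => [|n IHn]; first by rewrite /S big_geq // memvf; split=> // _ [].
  case: n IHn => [|n] IHn.
    by rewrite /S big_geq // memvf; split=> // _ [].
  rewrite /S big_nat_recr //= memv_cap; split.
    move=> /andP[/IHn vS vn] k /andP[k1]; rewrite ltnS leq_eqVlt.
    by move=> /orP[/eqP->//|kn]; apply: vS; rewrite k1.
  move=> vU; rewrite vU ?ltnSn // andbT; apply/IHn => k /andP[k1 kn].
  by apply: vU; rewrite k1 ltnW.
have SS m n : (m <= n)%N -> (S n <= S m)%VS.
  move=> mn; apply/subvP => v /SP vn; apply/SP => k /andP[k1 km].
  by apply: vn; rewrite k1 (leq_trans km).
pose P d := `[< exists n, \dim (S n) = d >].
have exP : exists d, P d by exists (\dim (S 0)); apply/asboolP; exists 0%N.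
case: (ex_minnP exP) => d /asboolP[N dN] dmin.
exists (S N) => v; split=> [vN k k1|vU]; last first.
  by apply/SP => k /andP[/vU].
suff /eqP eN : S (maxn N k.+1) == S N.
  by move: vN; rewrite -eN => /SP; apply; rewrite k1 leq_maxr.
rewrite eqEdim SS ?leq_maxl //= dN dmin //; apply/asboolP.
by exists (maxn N k.+1).
Qed.

Definition vbigsum : {vspace V} := sval (cid vbigsum_exists).
Definition vbigcap : {vspace V} := sval (cid vbigcap_exists).

Lemma mem_vbigsum v :
  v \in vbigsum <-> exists n, v \in (\sum_(1 <= k < n) U k)%VS.
Proof. by rewrite /vbigsum; case: cid. Qed.

Lemma mem_vbigcap v : v \in vbigcap <-> forall k, (1 <= k)%N -> v \in U k.
Proof. by rewrite /vbigcap; case: cid. Qed.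

End InfiniteFamilies.

HB.mixin Record Vector_isLieAlgebra (F : fieldType) g of Vector F g := {
  lie : g -> g -> g;
  lie_linearl : forall y, linear (lie^~ y);
  lie_linearr : forall x, linear (lie x);
  liexx : forall x, lie x x = 0;
  lie_jacobi : forall x y z,
    lie x (lie y z) + lie y (lie z x) + lie z (lie x y) = 0
}.

#[short(type="lieAlgType")]
HB.structure Definition LieAlgebra (F : fieldType) :=
  { g of Vector F g & Vector_isLieAlgebra F g }.

Section LieTheory.
Variables (F : fieldType) (g : lieAlgType F).
Implicit Types (x y z : g) (U V W : {vspace g}).

HB.instance Definition _ x :=
  GRing.isLinear.Build F g g *:%R (lie x) (lie_linearr x).

Definition ad x : 'End(g) := linfun (lie x).

Lemma adE x y : ad x y = lie x y.
Proof. by rewrite lfunE. Qed.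

Lemma ad_is_linear : linear ad.
Proof.
by move=> a x y; apply/lfunP => z; rewrite !lfunE /= !lfunE /= lie_linearl !lfunE.
Qed.

HB.instance Definition _ := GRing.isLinear.Build F g 'End(g) *:%R ad ad_is_linear.

Lemma lie0x y : lie 0 y = 0.
Proof. by rewrite -adE linear0 lfunE. Qed.

Lemma liex0 x : lie x 0 = 0.
Proof. exact: linear0. Qed.

Lemma lieDl x y z : lie (x + y) z = lie x z + lie y z.
Proof. by rewrite -!adE linearD lfunE. Qed.

Lemma lieDr x y z : lie z (x + y) = lie z x + lie z y.
Proof. exact: linearD. Qed.

Lemma lieC x y : lie x y = - lie y x.
Proof.
apply/eqP; rewrite -addr_eq0.
by have := liexx (x + y); rewrite lieDl !lieDr !liexx add0r addr0 => ->.
Qed.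

(* [U, V], the span of the brackets [u, v] with u in U and v in V. *)
Definition lieprod U V : {vspace g} :=
  <<[seq lie u v | u <- vbasis U, v <- vbasis V]>>%VS.

Lemma mem_lieprod U V x y : x \in U -> y \in V -> lie x y \in lieprod U V.
Proof.
move=> /coord_vbasis-> /coord_vbasis->; rewrite linear_sum.
apply: memv_suml => j _; rewrite linearZ /= memvZ // -adE linear_sum sum_lfunE.
apply: memv_suml => i _; rewrite linearZ lfunE /= memvZ // adE memv_span //.
by apply/allpairsP; exists ((vbasis U)`_i, (vbasis V)`_j); rewrite !memt_nth.
Qed.

Lemma lieprodP {U V W} :
  reflect (forall x y, x \in U -> y \in V -> lie x y \in W)
          (lieprod U V <= W)%VS.
Proof.
apply: (iffP idP) => [/subvP sW x y xU yV|sW]; first exact/sW/mem_lieprod.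
apply/span_subvP => _ /allpairsP[[u v] /= [/vbasis_mem uU /vbasis_mem vV ->]].
exact: sW.
Qed.

Definition abelian_lie U := lieprod U U == 0%VS.

Fixpoint descending k : {vspace g} :=
  if k is k'.+1 then lieprod fullv (descending k') else fullv.

Fixpoint derived k : {vspace g} :=
  if k is k'.+1 then lieprod (derived k') (derived k') else fullv.

Definition solvable_lie := exists k, derived k = 0%VS.

Definition center_lie : {vspace g} := lker (linfun ad).

Lemma mem_centerP x : reflect (forall y, lie x y = 0) (x \in center_lie).
Proof.
rewrite memv_ker lfunE; apply: (iffP eqP) => /= [x0 y|x0].
  by rewrite -adE x0 lfunE.
by apply/lfunP => y; rewrite adE x0 lfunE.
Qed.

Record lie_ideal := LieIdeal {
  ideal_vspace :> {vspace g};
  ideal_closed : (lieprod fullv ideal_vspace <= ideal_vspace)%VS }.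

Lemma ideal_lier (I : lie_ideal) x y : y \in (I : {vspace g}) ->
  lie x y \in (I : {vspace g}).
Proof. by move=> yI; apply: (lieprodP (ideal_closed I)); rewrite ?memvf. Qed.

Lemma ideal_liel (I : lie_ideal) x y : x \in (I : {vspace g}) ->
  lie x y \in (I : {vspace g}).
Proof. by move=> xI; rewrite lieC memvN ideal_lier. Qed.

Lemma zero_ideal_closed : (lieprod fullv 0 <= (0 : {vspace g}))%VS.
Proof. by apply/lieprodP => x y _; rewrite !memv0 => /eqP->; rewrite liex0. Qed.

Definition zero_ideal := LieIdeal zero_ideal_closed.

Lemma center_ideal_closed : (lieprod fullv center_lie <= center_lie)%VS.
Proof.
by apply/lieprodP => x y _ /mem_centerP yC; rewrite lieC yC oppr0 mem0v.
Qed.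

Definition center_ideal := LieIdeal center_ideal_closed.

End LieTheory.

(* The quotient g / I, carried by the complement I^C, which is identified with
   the vector space g / I through the projection along I. *)
Definition lie_quot (F : fieldType) (g : lieAlgType F) (I : lie_ideal g) :=
  subvs_of (I^C)%VS.

Section Quotient.
Variables (F : fieldType) (g : lieAlgType F) (I : lie_ideal g).
Local Notation Q := (lie_quot I).

HB.instance Definition _ := Vector.on Q.

Definition quot_proj : 'Hom(g, Q) :=
  (linfun (vsproj (I^C)%VS) \o daddv_pi (I^C)%VS I)%VF.

Local Notation pi := quot_proj.

Let capIC : (I^C :&: I = 0)%VS.
Proof. by rewrite capvC capv_compl. Qed.

Lemma val_quot_proj x : vsval (pi x) = daddv_pi (I^C)%VS I x.
Proof. by rewrite comp_lfunE lfunE /= vsprojK // memv_pi. Qed.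

Lemma quot_projK (a : Q) : pi (vsval a) = a.
Proof. by apply: val_inj; rewrite /= val_quot_proj daddv_pi_id ?subvsP. Qed.

Lemma lker_quot_proj : lker pi = I.
Proof.
apply/vspaceP => x; rewrite memv_ker -(inj_eq val_inj) /= val_quot_proj.
have := @daddv_pi_add _ _ _ _ x capIC.
rewrite addvC addv_complf memvf => /(_ isT) ex.
apply/eqP/idP => [x0|xI]; first by rewrite -ex x0 add0r memv_pi.
have : daddv_pi (I^C)%VS I x \in (I^C :&: I)%VS.
  rewrite memv_cap memv_pi /=; have -> : daddv_pi (I^C)%VS I x =
    x - daddv_pi I (I^C)%VS x by rewrite -[X in X - _]ex addrK.
  by rewrite rpredB // memv_pi.
by rewrite capIC memv0 => /eqP.
Qed.

Lemma quot_proj_eq0 x : (pi x == 0) = (x \in (I : {vspace g})).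
Proof. by rewrite -memv_ker lker_quot_proj. Qed.

Definition quot_lie (a b : Q) : Q := pi (lie (vsval a) (vsval b)).

Lemma quot_proj_lie x y : pi (lie x y) = quot_lie (pi x) (pi y).
Proof.
have dI z : z - vsval (pi z) \in (I : {vspace g}).
  by rewrite -quot_proj_eq0 linearB /= quot_projK subrr.
have ker z : z \in (I : {vspace g}) -> pi z = 0.
  by rewrite -quot_proj_eq0 => /eqP.
rewrite /quot_lie -[in LHS](subrK (vsval (pi x)) x) lieDl linearD /=.
rewrite ker ?ideal_liel // add0r.
by rewrite -[in LHS](subrK (vsval (pi y)) y) lieDr linearD /= ker ?ideal_lier ?add0r.
Qed.

Lemma quot_lie_linearl b : linear (quot_lie^~ b).
Proof.
move=> c a a'; rewrite /quot_lie -linearP -lie_linearl.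
by congr (pi (lie _ _)); rewrite linearP.
Qed.

Lemma quot_lie_linearr a : linear (quot_lie a).
Proof.
move=> c b b'; rewrite /quot_lie -linearP -lie_linearr.
by congr (pi (lie _ _)); rewrite linearP.
Qed.

Lemma quot_liexx a : quot_lie a a = 0.
Proof. by rewrite /quot_lie liexx linear0. Qed.

Lemma quot_lie_jacobi a b c :
  quot_lie a (quot_lie b c) + quot_lie b (quot_lie c a)
    + quot_lie c (quot_lie a b) = 0.
Proof.
rewrite -(quot_projK a) -(quot_projK b) -(quot_projK c).
by rewrite -!quot_proj_lie -!linearD lie_jacobi linear0.
Qed.

HB.instance Definition _ := Vector_isLieAlgebra.Build F Q
  quot_lie_linearl quot_lie_linearr quot_liexx quot_lie_jacobi.

Lemma preim_center_mem x : reflect (forall y, lie x y \in (I : {vspace g}))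
  (x \in (pi @^-1: center_lie Q)%VS).
Proof.
rewrite -memv_preim; apply: (iffP (mem_centerP _)) => xC y.
  by rewrite -quot_proj_eq0 quot_proj_lie; apply/eqP/xC.
have := xC (vsval y); rewrite -quot_proj_eq0.
by rewrite quot_proj_lie quot_projK => /eqP.
Qed.

Lemma preim_center_closed :
  (lieprod fullv (pi @^-1: center_lie Q) <= pi @^-1: center_lie Q)%VS.
Proof.
apply/lieprodP => x y _ /preim_center_mem yC; apply/preim_center_mem => z.
by rewrite ideal_liel // lieC memvN yC.
Qed.

Definition preim_center_ideal := LieIdeal preim_center_closed.

End Quotient.

Section CentralSeries.
Variables (F : fieldType) (g : lieAlgType F).

(* C_k(g) for k >= 1; the value at k = 0 is a dummy. *)
Fixpoint central k : lie_ideal g :=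
  match k with
  | 0 => zero_ideal g
  | k'.+1 => match k' with
             | 0 => center_ideal g
             | _ => preim_center_ideal (central k')
             end
  end.

Definition i_lie : {vspace g} :=
  vbigsum (fun k => (central k :&: descending g k)%VS).

Definition j_lie : {vspace g} :=
  vbigcap (fun k => (central k + descending g k)%VS).

Definition invariant_metric (B : {symmetric g}) : Prop :=
  nondegenerate B /\ forall x y z : g, B (lie x y) z = B x (lie y z).

Lemma mem_central1 x :
  x \in (central 1 : {vspace g}) <-> forall y, lie x y = 0.
Proof. by split=> /mem_centerP. Qed.

Lemma mem_centralS k x : (1 <= k)%N ->
  x \in (central k.+1 : {vspace g}) <->
  forall y, lie x y \in (central k : {vspace g}).
Proof. by case: k => // k _; split=> /preim_center_mem. Qed.

End CentralSeries.

(* Main.v *)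
From HB Require Import structures.
Require Import Defs.
From mathcomp Require Import all_boot all_order all_algebra.
From mathcomp Require Import boolp.
Set Implicit Arguments.
Unset Strict Implicit.
Unset Printing Implicit Defensive.
Import GRing.Theory.
Local Open Scope ring_scope.

(** Write C_k for the derived central series and D_k for the descending one,
    so that C_0 = 0 and D_0 = g.  Since C_k increases and D_k decreases, the
    modular law turns the finite intersection of the C_k + D_k, 1 <= k <= m,
    into the sum of the layers C_(k+1) n D_k, 0 <= k < m, and of D_m
    ([layersS]).  In finite dimension this intersection is constant for large
    m, hence equal to j(g) ([j_lieE]); this is (ii).

    For (iii), the Jacobi identity gives [C_(k+l+1), D_l] <= C_k, so that
    C_(k+1) commutes with D_l as soon as k <= l ([lieprod_central_descending0]).
    Two layers therefore always commute, each layer with k < m commutes with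
    D_m, and the only bracket left in [j(g), j(g)] is [D_m, D_m].

    For (iv), an invariant metric exchanges the two series: the orthogonal of
    D_k is C_k ([orthov_descending]).  As orthogonality in a nondegenerate
    space exchanges sums and intersections ([orthovK], [orthov_cap]), it maps
    i(g) to j(g) ([orthov_i_lie]).  When j(g) is Abelian, invariance makes
    [g, j(g)] orthogonal to j(g), that is, puts it in i(g).  For (v), if
    i(g) = 0 then j(g) = 0^perp = g, which is Abelian by (iii); and j(g)
    contains i(g). *)

(** * Infinite families of subspaces *)

Section Families.
Variables (F : fieldType) (V : vectType F).
Implicit Types (U : nat -> {vspace V}) (W : {vspace V}).

Lemma vbigsum_subP U W :
  (vbigsum U <= W)%VS <-> forall k, (1 <= k)%N -> (U k <= W)%VS.
Proof.
split=> [/subvP sUW k k1|sUW].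
  apply/subvP => v vU; apply/sUW/mem_vbigsum; exists k.+1.
  by rewrite big_nat_recr //= -[v]add0r memv_add ?mem0v.
apply/subvP => v /mem_vbigsum[n]; apply/subvP: v.
rewrite big_seq; apply: (big_ind (fun A => A <= W)%VS); first exact: sub0v.
  by move=> A B AW BW; rewrite subv_add AW.
by move=> k; rewrite mem_index_iota => /andP[/sUW].
Qed.

Lemma sub_vbigcapP U W :
  (W <= vbigcap U)%VS <-> forall k, (1 <= k)%N -> (W <= U k)%VS.
Proof.
split=> [/subvP sWU k k1|sWU]; apply/subvP => v vW.
  by apply: (mem_vbigcap U v).1 k k1; apply: sWU.
by apply/mem_vbigcap => k /sWU/subvP; apply.
Qed.

Lemma decreasing_subv U : (forall n, (U n.+1 <= U n)%VS) ->
  forall m n, (m <= n)%N -> (U n <= U m)%VS.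
Proof.
move=> Udec m n /subnK<-; elim: (n - m)%N => [|d IHd]; first exact: subvv.
exact: subv_trans (Udec _) IHd.
Qed.

Lemma decreasing_stable U : (forall n, (U n.+1 <= U n)%VS) ->
  exists N, forall n, (N <= n)%N -> U n = U N.
Proof.
move=> Udec; pose P d := `[< exists n, \dim (U n) = d >].
have exP : exists d, P d by exists (\dim (U 0%N)); apply/asboolP; exists 0%N.
case: (ex_minnP exP) => d /asboolP[N dN] dmin; exists N => n Nn.
apply/eqP; rewrite eqEdim decreasing_subv //= dN dmin //.
by apply/asboolP; exists n.
Qed.

End Families.

(** * Brackets of subspaces *)

Section LieProducts.
Variables (F : fieldType) (g : lieAlgType F).
Implicit Types (U V W : {vspace g}).

Lemma lieprodC U V : lieprod U V = lieprod V U.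
Proof.
have sub (A B : {vspace g}) : (lieprod A B <= lieprod B A)%VS.
  by apply/lieprodP => x y xA yB; rewrite lieC memvN mem_lieprod.
by apply/eqP; rewrite eqEsubv !sub.
Qed.

Lemma lieprodS U U' V V' :
  (U <= U')%VS -> (V <= V')%VS -> (lieprod U V <= lieprod U' V')%VS.
Proof.
by move=> /subvP UU' /subvP VV'; apply/lieprodP => x y /UU' ? /VV' ?;
  apply: mem_lieprod.
Qed.

Lemma lieprod0l W : lieprod 0 W = 0%VS.
Proof.
apply/eqP; rewrite -subv0; apply/lieprodP => x y.
by rewrite memv0 => /eqP-> _; rewrite lie0x mem0v.
Qed.

Lemma lieprodDl W : {morph (fun U => lieprod U W) : U V / (U + V)%VS}.
Proof.
move=> U V; apply/eqP; rewrite eqEsubv; apply/andP; split; last first.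
  by rewrite subv_add !lieprodS ?addvSl ?addvSr ?subvv.
apply/lieprodP => _ y /memv_addP[u uU [v vV ->]] yW.
by rewrite lieDl memv_add ?mem_lieprod.
Qed.

Lemma lieprod_suml I (r : seq I) (P : pred I) (U : I -> {vspace g}) W :
  lieprod (\sum_(i <- r | P i) U i)%VS W
    = (\sum_(i <- r | P i) lieprod (U i) W)%VS.
Proof. exact: (big_morph _ (lieprodDl W) (lieprod0l W)). Qed.

Lemma lie_jacobi_deriv (x y z : g) :
  lie x (lie y z) = lie (lie x y) z + lie y (lie x z).
Proof.
have := lie_jacobi x y z.
rewrite (lieC z x) (lieC z (lie x y)) raddfN -addrA -opprD.
by move=> /subr0_eq->; rewrite addrC.
Qed.

Lemma lieprod_jacobi U V W :
  (lieprod U (lieprod V W)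
     <= lieprod (lieprod U V) W + lieprod V (lieprod U W))%VS.
Proof.
set X := (_ + _)%VS; apply/lieprodP => x d xU dVW; rewrite -adE memv_preim.
apply: subvP dVW; apply/lieprodP => y z yV zW; rewrite -memv_preim adE.
by rewrite lie_jacobi_deriv memv_add ?mem_lieprod.
Qed.

Lemma sub_abelian_lie U V : (U <= V)%VS -> abelian_lie V -> abelian_lie U.
Proof.
by move=> UV /eqP V0; rewrite /abelian_lie -subv0 -V0 lieprodS.
Qed.

End LieProducts.

(** * The two central series *)

Section Series.
Variables (F : fieldType) (g : lieAlgType F).
Local Notation C k := (central g k : {vspace g}).
Local Notation D := (descending g).

(** The convention C_0 = 0 fits the recursion, which makes all the statements
    below valid from index 0 on. *)
Lemma mem_central k (x : g) : x \in C k.+1 <-> forall y, lie x y \in C k.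
Proof.
case: k => [|k]; last exact: mem_centralS.
rewrite mem_central1; split=> xC y; first by rewrite xC mem0v.
by apply/eqP; rewrite -memv0; apply: xC.
Qed.

Lemma central_subS k : (C k <= C k.+1)%VS.
Proof. by apply/subvP => x xC; apply/mem_central => y; apply: ideal_liel. Qed.

Lemma central_sub k l : (k <= l)%N -> (C k <= C l)%VS.
Proof.
move=> /subnK<-; elim: (l - k)%N => [|d IHd]; first exact: subvv.
exact: subv_trans IHd (central_subS _).
Qed.

Lemma descending_subS k : (D k.+1 <= D k)%VS.
Proof.
by elim: k => [|k IHk]; [exact: subvf | exact: lieprodS (subvv _) IHk].
Qed.

Lemma descending_sub k l : (k <= l)%N -> (D l <= D k)%VS.
Proof. exact: decreasing_subv descending_subS k l. Qed.

Lemma lieprod_central k : (lieprod fullv (C k.+1) <= C k)%VS.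
Proof. by apply/lieprodP => x y _ /mem_central yC; rewrite lieC memvN. Qed.

(** D_l is spanned by iterated brackets of l + 1 elements of g.  By the Jacobi
    identity, bracketing with such an element amounts to bracketing with its
    l + 1 entries in various orders, and each entry costs one step in the
    derived central series. *)
Lemma lieprod_central_descending k l :
  (lieprod (C (k + l).+1) (D l) <= C k)%VS.
Proof.
elim: l k => [|l IHl] k; first by rewrite addn0 lieprodC lieprod_central.
apply: subv_trans (lieprod_jacobi _ _ _) _; rewrite subv_add; apply/andP; split.
  apply: subv_trans (IHl k); rewrite lieprodS ?subvv //.
  by rewrite lieprodC addnS lieprod_central.
apply: subv_trans (lieprod_central k); rewrite lieprodS ?subvv //.
by rewrite -addSnnS IHl.
Qed.

Lemma lieprod_central_descending0 k l :
  (k <= l)%N -> lieprod (C k.+1) (D l) = 0%VS.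
Proof.
move=> kl; apply/eqP; rewrite -subv0.
apply: subv_trans (lieprod_central_descending 0 l).
by rewrite lieprodS ?subvv ?central_sub.
Qed.

(** ** Layers and finite intersections *)

(** The layer k = 0 is the center, since D_0 = g. *)
Definition layers m := (\sum_(0 <= k < m) (C k.+1 :&: D k) + D m)%VS.

Lemma sum_layers_sub m : (\sum_(0 <= k < m) (C k.+1 :&: D k) <= C m)%VS.
Proof.
rewrite big_mkord; apply/subv_sumP => k _.
exact: subv_trans (capvSl _ _) (central_sub (ltn_ord k)).
Qed.

(** The layers below m lie in C_m, hence in C_(m+1), while D_(m+1) lies in D_m:
    these are the two inclusions that the modular law needs. *)
Lemma layersS m : layers m.+1 = (layers m :&: (C m.+1 + D m.+1))%VS.
Proof.
rewrite /layers -vspace_modl; last first.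
  apply: subv_trans (addvSl _ _).
  exact: subv_trans (sum_layers_sub m) (central_subS m).
rewrite -vspace_modr ?descending_subS // capvC addvA.
by rewrite big_nat_recr.
Qed.

Lemma j_lieE : exists N, forall m, (N <= m)%N -> j_lie g = layers m.
Proof.
have Ldec m : (layers m.+1 <= layers m)%VS by rewrite layersS capvSl.
have [N LN] := decreasing_stable Ldec; exists N => m Nm; rewrite LN //.
apply/eqP; rewrite eqEsubv; apply/andP; split.
  elim: (N) => [|n IHn]; first by rewrite /layers addvf subvf.
  by rewrite layersS subv_cap IHn; apply: (sub_vbigcapP _ _).1 (subvv _) _ _.
apply/sub_vbigcapP => -[//|k] _.
rewrite -(LN (maxn N k.+1)) ?leq_maxl //.
apply: subv_trans (decreasing_subv Ldec (leq_maxr N k.+1)) _.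
by rewrite layersS capvSr.
Qed.

Lemma i_lie_sub_j_lie : (i_lie g <= j_lie g)%VS.
Proof.
apply/vbigsum_subP => k _; apply/sub_vbigcapP => l _.
case/orP: (leq_total k l) => kl.
  apply: subv_trans (addvSl _ _).
  exact: subv_trans (capvSl _ _) (central_sub kl).
apply: subv_trans (addvSr _ _).
exact: subv_trans (capvSr _ _) (descending_sub kl).
Qed.

(** Of two layers, the one with the smaller index k lies in C_(k+1) and the
    other one in D_k, which commute. *)
Lemma lieprod_layer k l :
  lieprod (C k.+1 :&: D k)%VS (C l.+1 :&: D l)%VS = 0%VS.
Proof.
have comm i j : (i <= j)%N ->
    lieprod (C i.+1 :&: D i)%VS (C j.+1 :&: D j)%VS = 0%VS.
  move=> ij; apply/eqP; rewrite -subv0 -(lieprod_central_descending0 ij).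
  by rewrite lieprodS ?capvSl ?capvSr.
by case/orP: (leq_total k l) => kl; [|rewrite lieprodC]; apply: comm.
Qed.

Lemma abelian_layers m : abelian_lie (D m) -> abelian_lie (layers m).
Proof.
move=> /eqP DD; rewrite /abelian_lie /layers.
set S := (\sum_(0 <= k < m) _)%VS.
have SD : lieprod S (D m) = 0%VS.
  rewrite lieprod_suml big1_seq // => k; rewrite mem_index_iota => /andP[_ km].
  apply/eqP; rewrite -subv0 -(lieprod_central_descending0 (ltnW km)).
  by rewrite lieprodS ?capvSl ?subvv.
have SS : lieprod S S = 0%VS.
  rewrite lieprod_suml big1 // => k _; rewrite lieprodC lieprod_suml.
  by rewrite big1 // => l _; apply: lieprod_layer.
rewrite lieprodDl (lieprodC S) (lieprodC (D m)) !lieprodDl.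
by rewrite (lieprodC (D m) S) SS SD DD !addv0.
Qed.

Lemma abelian_j_lieP : abelian_lie (j_lie g) <->
  exists2 l, (1 <= l)%N & abelian_lie (D l).
Proof.
have [N jE] := j_lieE; split=> [jab|[l l1 Dab]].
  exists N.+1 => //; apply: sub_abelian_lie jab.
  by rewrite (jE N.+1) // addvSr.
rewrite (jE (maxn N l)) ?leq_maxl //; apply: abelian_layers.
exact: sub_abelian_lie (descending_sub (leq_maxr N l)) Dab.
Qed.

End Series.

(** * Orthogonality for a nondegenerate symmetric form *)

Section Orthogonality.
Variables (F : fieldType) (V : vectType F) (B : {symmetric V}).
Implicit Types (U W : {vspace V}).

Lemma symC (x y : V) : B x y = B y x.
Proof. by rewrite hermC expr0 mul1r. Qed.

Lemma sub_orthov U W : (U <= W)%VS -> (orthov B W <= orthov B U)%VS.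
Proof.
move=> /subvP UW; apply/orthovP => x y /mem_orthovP xW /UW; exact: xW.
Qed.

Lemma orthov_add U W : orthov B (U + W) = (orthov B U :&: orthov B W)%VS.
Proof.
apply/eqP; rewrite eqEsubv subv_cap !sub_orthov ?addvSl ?addvSr //=.
by rewrite orthovD capvSl capvSr.
Qed.

Hypothesis ndB : nondegenerate B.

(** The Gram map x |-> (B(x, e_i))_i for a basis e is injective by
    nondegeneracy, hence onto. *)
Lemma nondegenerate_riesz (f : 'Hom(V, F^o)) : exists y, forall x, B y x = f x.
Proof.
pose e := vbasis (fullv : {vspace V}).
pose T x := \sum_(i < \dim {:V}) B x e`_i *: e`_i.
have Tlin : linear T.
  move=> a x y; rewrite /T scaler_sumr -big_split; apply: eq_bigr => i _ /=.
  by rewrite linearPl scalerDl scalerA.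
pose TL := GRing.isLinear.Build F V V *:%R T Tlin.
pose Tm : {linear V -> V} := HB.pack T TL.
have freeE : forall c c' : 'I_(\dim {:V}) -> F,
    \sum_i c i *: e`_i = \sum_i c' i *: e`_i -> c =1 c'.
  move=> c c' cc i; have /freeP fe := basis_free (vbasisP (fullv : {vspace V})).
  apply/eqP; rewrite -subr_eq0; apply/eqP; apply: (fe (fun i => c i - c' i)).
  under eq_bigr do rewrite scalerBl.
  by rewrite sumrB cc subrr.
have eq_on_basis y : T y = \sum_(i < \dim {:V}) f e`_i *: e`_i ->
    forall x, B y x = f x.
  move=> /freeE BE x; rewrite (coord_vbasis (memvf x)) linear_sumr linear_sum.
  by apply: eq_bigr => i _; rewrite linearZr linearZ /= BE.
have : lker (linfun Tm) == 0%VS.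
  rewrite -subv0; apply/subvP => x; rewrite memv_ker lfunE /= => /eqP Tx.
  rewrite -(eqP ndB); apply/mem_orthovP => y _.
  rewrite (coord_vbasis (memvf y)) linear_sumr big1 // => i _.
  rewrite linearZr /= (freeE (fun i => B x e`_i) (fun=> 0)) ?mulr0 //.
  by rewrite [LHS]Tx big1 // => j _; rewrite scale0r.
move=> /lker0_limgf Tonto.
have : (\sum_(i < \dim {:V}) f e`_i *: e`_i) \in limg (linfun Tm).
  by rewrite Tonto memvf.
case/memv_imgP => y _; rewrite lfunE /= => yE.
by exists y; apply: eq_on_basis.
Qed.

(** A vector outside U is separated by a linear form that vanishes on U; the
    vector representing this form is orthogonal to U. *)
Lemma orthovK U : orthov B (orthov B U) = U.
Proof.
apply/eqP; rewrite eqEsubv; apply/andP; split; last first.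
  by rewrite orthov_sym subvv.
apply/subvP => x xUU; apply: contraT => xU.
(* q vanishes on U but not at x, so one of its coordinates separates x *)
pose q : 'End(V) := (\1 - projv U)%VF.
have qE z : q z = z - projv U z by rewrite !lfunE /= !lfunE /=.
have : q x != 0.
  by apply: contra xU; rewrite qE subr_eq0 => /eqP->; rewrite memv_proj.
rewrite (coord_vbasis (memvf (q x))) => qx0.
have [i ci] : exists i, coord (vbasis fullv) i (q x) != 0.
  apply/existsP; apply: contraNT qx0; rewrite negb_exists => /forallP c0.
  rewrite big1 // => i _.
  by move: (c0 i); rewrite negbK => /eqP->; rewrite scale0r.
have [y yE] := nondegenerate_riesz
  (linfun (coord (vbasis fullv) i : V -> F^o) \o q)%VF.
have yU : y \in orthov B U.
  apply/mem_orthovP => z zU; rewrite yE comp_lfunE lfunE /= qE projv_id //.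
  by rewrite subrr linear0.
have /mem_orthovP/(_ y yU) := xUU; rewrite symC yE comp_lfunE lfunE /=.
by move=> c0; rewrite c0 eqxx in ci.
Qed.

Lemma orthov_cap U W : orthov B (U :&: W) = (orthov B U + orthov B W)%VS.
Proof.
by rewrite -[RHS]orthovK orthov_add !orthovK.
Qed.

End Orthogonality.

(** * Invariant metrics *)

Section InvariantMetric.
Variables (F : fieldType) (g : lieAlgType F) (B : {symmetric g}).
Hypothesis metB : invariant_metric B.
Local Notation C k := (central g k : {vspace g}).
Local Notation D := (descending g).

Let ndB : nondegenerate B := metB.1.
Let invB : forall x y z : g, B (lie x y) z = B x (lie y z) := metB.2.

(** By invariance, x is orthogonal to all the brackets [y, d] with d in D_k if
    and only if all the brackets [x, y] are orthogonal to D_k. *)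
Lemma orthov_descending k : orthov B (D k) = C k.
Proof.
elim: k => [|k IHk]; first exact/eqP.
apply/vspaceP => x; apply/idP/idP.
  move=> /mem_orthovP xD; apply/mem_central => y.
  rewrite -IHk; apply/mem_orthovP => d dD.
  by rewrite invB xD // mem_lieprod ?memvf.
move=> /mem_central xC; rewrite mem_orthov_sym; apply/lieprodP => y d _ dD.
rewrite -mem_orthov1_sym mem_orthov1 -invB; apply/eqP.
by move: (xC y); rewrite -IHk => /mem_orthovP; apply.
Qed.

Lemma orthov_i_lie : orthov B (i_lie g) = j_lie g.
Proof.
have capE k : orthov B (C k :&: D k) = (C k + D k)%VS.
  rewrite orthov_cap // -orthov_descending orthovK //.
  by rewrite orthov_descending addvC.
apply/eqP; rewrite eqEsubv; apply/andP; split.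
  apply/sub_vbigcapP => k k1; rewrite -capE sub_orthov //.
  exact: (vbigsum_subP _ _).1 (subvv _) k k1.
rewrite orthov_sym; apply/vbigsum_subP => k k1; rewrite orthov_sym capE.
exact: (sub_vbigcapP _ _).1 (subvv _) k k1.
Qed.

(** For y, z in j(g), B([x, y], z) = B(x, [y, z]) = 0, so that [x, y] lies in
    the orthogonal of j(g) = i(g)^perp. *)
Lemma lieprod_j_lie_sub_i_lie :
  abelian_lie (j_lie g) -> (lieprod fullv (j_lie g) <= i_lie g)%VS.
Proof.
move=> /eqP jab; rewrite -(orthovK ndB (i_lie g)) orthov_i_lie.
apply/lieprodP => x y _ yj; apply/mem_orthovP => z zj.
have : lie y z \in lieprod (j_lie g) (j_lie g) by rewrite mem_lieprod.
by rewrite jab memv0 invB => /eqP->; rewrite linear0r.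
Qed.

Lemma i_lie_neq0 : ~~ abelian_lie (fullv : {vspace g}) ->
  abelian_lie (j_lie g) -> i_lie g <> 0%VS.
Proof.
by move=> nab jab i0; move: jab; rewrite -orthov_i_lie i0 orthov0 (negPf nab).
Qed.

End InvariantMetric.

(** * The ideals i(g) and j(g) *)

Theorem lemma2p7 (F : fieldType) (charF : [pchar F] =i pred0)
    (g : lieAlgType F) :
  [/\ (i_lie g <= j_lie g)%VS,
      exists2 m : nat, (1 <= m)%N &
        j_lie g = (center_lie g
                   + \sum_(1 <= k < m) (central g k.+1 :&: descending g k)
                   + descending g m)%VS,
      abelian_lie (j_lie g) <->
        (exists2 l : nat, (1 <= l)%N & abelian_lie (descending g l)),
      forall B : {symmetric g}, invariant_metric B ->
        abelian_lie (j_lie g) ->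
        (lieprod fullv (j_lie g) <= i_lie g)%VS /\
        orthov B (i_lie g) = j_lie g
    & forall B : {symmetric g}, invariant_metric B ->
        solvable_lie g -> ~~ abelian_lie (fullv : {vspace g}) ->
        (exists2 l : nat, (1 <= l)%N & abelian_lie (descending g l)) ->
        i_lie g <> 0%VS /\ j_lie g <> 0%VS].
Proof.
split.
- exact: i_lie_sub_j_lie.
- have [N jE] := j_lieE g; exists N.+1 => //.
  by rewrite (jE N.+1) // /layers big_ltn //= capvf.
- exact: abelian_j_lieP.
- move=> B metB jab; split; first exact: lieprod_j_lie_sub_i_lie metB jab.
  exact: orthov_i_lie metB.
- move=> B metB _ nab /abelian_j_lieP jab.
  have i0 := i_lie_neq0 metB nab jab; split=> // j0; apply: i0.
  by apply/eqP; rewrite -subv0 -j0 i_lie_sub_j_lie.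
Qed.
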